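(* Let $g:(0,1)\to\mathbb{R}$ be a real function. The following conditions are equivalent: (i) $\lim_{z\to 0}g(z)=0$, $g$ is continuously differentiable, and $\frac{1}{1+z}\le g'(z)\le\frac{1}{1-z}$ for all $0<z<1$; (ii) there exists a continuous Seiffert function $f$ such that $g=I(f)$, i.e. $g(z)=\int_0^z\frac{f(u)}{u}\,du$ for all $0<z<1$.
   Context: A Seiffert function is a function $f:(0,1)\to\mathbb{R}$ satisfying $\frac{z}{1+z}\le f(z)\le\frac{z}{1-z}$ for all $0<z<1$. For a continuous Seiffert function $f$, the operator $I$ is defined by $I(f)(z)=\int_0^z\frac{f(u)}{u}\,du$, $0<z<1$. *)

(* Defs.v *)
From Stdlib Require Import Reals.
From Coquelicot Require Import Coquelicot.

Open Scope R_scope.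

(* A function (0,1) -> R is represented by a total function R -> R of which
   only the values on the open interval (0,1) matter. *)

Definition seiffert (f : R -> R) : Prop :=
  forall z : R, 0 < z < 1 -> z / (1 + z) <= f z <= z / (1 - z).

Definition continuous_on_01 (f : R -> R) : Prop :=
  forall z : R, 0 < z < 1 -> continuous f z.

Definition continuously_differentiable_on_01 (g : R -> R) : Prop :=
  (forall z : R, 0 < z < 1 -> ex_derive g z) /\ continuous_on_01 (Derive g).

(* For a continuous Seiffert function f, the integrand is continuous on (0,1)
   and lies between 1 / (1 + u) and 1 / (1 - u), so the Riemann integral exists
   for 0 < z < 1; it does not depend on the junk value f 0 / 0 at the endpoint. *)
Definition seiffert_I (f : R -> R) (z : R) : R :=
  RInt (fun u : R => f u / u) 0 z.

(* Main.v *)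
Require Import Defs.
From Stdlib Require Import Reals Lra.
From Coquelicot Require Import Coquelicot.

Open Scope R_scope.

(** The bounds on a Seiffert function [f] squeeze [f u / u] between
    [1 / (1 + u)] and [1 / (1 - u)], so [f u / u] tends to [1] at [0+].
    Extended by [1] to the left of [0] the integrand is therefore continuous on
    [(-oo, 1)], and its primitive is the function [I f] on [(0, 1)], vanishes at
    [0] and has derivative [f u / u].  Conversely, [f u = u * g' u] is forced, and
    [g - I f] is a constant whose limit at [0+] is [0]. *)

Definition integrand_ext (f : R -> R) (u : R) : R :=
  if Rle_dec u 0 then 1 else f u / u.

Lemma integrand_ext_pos (f : R -> R) (u : R) :
  0 < u -> integrand_ext f u = f u / u.
Proof.
  intros Hu; unfold integrand_ext; destruct (Rle_dec u 0); [lra | reflexivity].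
Qed.

Lemma locally_open_interval (a b z : R) :
  a < z < b -> locally z (fun x : R => a < x < b).
Proof.
  intros [Ha Hb].
  apply filter_and; [now apply open_gt | now apply open_lt].
Qed.

Lemma seiffert_quotient_bounds (f : R -> R) (u : R) :
  seiffert f -> 0 < u < 1 -> 1 / (1 + u) <= f u / u <= 1 / (1 - u).
Proof.
  intros Hf Hu; destruct (Hf u Hu) as [Hl Hr].
  replace (1 / (1 + u)) with (u / (1 + u) / u) by (field; lra).
  replace (1 / (1 - u)) with (u / (1 - u) / u) by (field; lra).
  split; apply Rmult_le_compat_r; trivial;
    apply Rlt_le, Rinv_0_lt_compat; lra.
Qed.

(** The lower bound comes from [(1 - u) * (1 + u) <= 1]. The upper one amounts to [2 * u ^ 2 <= u],
    which is where the restriction to [u < 1 / 2] enters. *)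
Lemma seiffert_quotient_near_1 (f : R -> R) (u : R) :
  seiffert f -> 0 < u < 1 / 2 -> Rabs (f u / u - 1) <= 2 * u.
Proof.
  intros Hf Hu.
  destruct (seiffert_quotient_bounds f u Hf) as [Hl Hr]; [lra |].
  assert (1 - u <= 1 / (1 + u)).
  { apply Rle_div_r; [lra | nra]. }
  assert (1 / (1 - u) <= 1 + 2 * u).
  { apply Rle_div_l; [lra | nra]. }
  apply Rabs_le; lra.
Qed.

Lemma continuous_quotient (f : R -> R) (z : R) :
  z <> 0 -> continuous f z -> continuous (fun u : R => f u / u) z.
Proof.
  intros Hz Hf.
  apply (continuous_mult f (fun u : R => / u)); trivial.
  apply continuous_Rinv_comp; trivial.
  apply continuous_id.
Qed.

Lemma integrand_ext_continuous (f : R -> R) (z : R) :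
  seiffert f -> continuous_on_01 f -> z < 1 -> continuous (integrand_ext f) z.
Proof.
  intros Hf Hc Hz.
  destruct (Rtotal_order z 0) as [Hneg | [-> | Hpos]].
  - apply continuous_ext_loc with (fun _ : R => 1).
    + apply (filter_imp (fun x : R => x < 0)); [| now apply open_lt].
      intros x Hx; unfold integrand_ext.
      destruct (Rle_dec x 0); [reflexivity | lra].
    + apply continuous_const.
  - apply filterlim_locally; intros eps.
    (* The bound [1 / 2] permits the estimate [2 * y] for [y > 0], and [eps / 2] makes that estimate
       smaller than [eps]. *)
    assert (Hd : 0 < Rmin (1 / 2) (eps / 2)).
    { apply Rmin_pos; [lra |]; pose proof (cond_pos eps); lra. }
    exists (mkposreal _ Hd); intros y Hy.
    change (Rabs (y - 0) < Rmin (1 / 2) (eps / 2)) in Hy.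
    change (Rabs (integrand_ext f y - integrand_ext f 0) < eps).
    pose proof (Rmin_l (1 / 2) (eps / 2)); pose proof (Rmin_r (1 / 2) (eps / 2)).
    pose proof (cond_pos eps); apply Rabs_def2 in Hy.
    unfold integrand_ext; destruct (Rle_dec 0 0); [| lra].
    destruct (Rle_dec y 0).
    + rewrite Rminus_diag, Rabs_R0; lra.
    + apply Rle_lt_trans with (2 * y); [| lra].
      apply seiffert_quotient_near_1; trivial; lra.
  - apply continuous_ext_loc with (fun u : R => f u / u).
    + apply (filter_imp (fun x : R => 0 < x)); [| now apply open_gt].
      intros x Hx; symmetry; now apply integrand_ext_pos.
    + apply continuous_quotient; [lra |]; apply Hc; lra.
Qed.

(** The integral ignores the endpoints, so the integrands need to agree only on the open interval;
    at [0] one is [f 0 / 0] and the other [1]. *)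
Lemma seiffert_I_ext (f : R -> R) (z : R) :
  0 < z -> seiffert_I f z = RInt (integrand_ext f) 0 z.
Proof.
  intros Hz; apply RInt_ext; intros x [Hx _].
  rewrite Rmin_left in Hx by lra.
  symmetry; now apply integrand_ext_pos.
Qed.

(** Allowing every [z < 1] includes [z = 0], where the two-sided derivative exists thanks to the
    extension to the left; this gives the limit of [seiffert_I f] at [0+]. *)
Lemma is_derive_RInt_integrand_ext (f : R -> R) (z : R) :
  seiffert f -> continuous_on_01 f -> z < 1 ->
  is_derive (RInt (integrand_ext f) 0) z (integrand_ext f z).
Proof.
  intros Hf Hc Hz.
  apply (is_derive_RInt (integrand_ext f) _ 0).
  - apply (filter_imp (fun x : R => x < 1)); [| now apply open_lt].
    intros x Hx; apply (RInt_correct (integrand_ext f) 0 x).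
    apply (ex_RInt_continuous (integrand_ext f)); intros y [_ Hy].
    apply integrand_ext_continuous; trivial.
    apply Rle_lt_trans with (1 := Hy), Rmax_lub_lt; lra.
  - now apply integrand_ext_continuous.
Qed.

Lemma is_derive_seiffert_I (f : R -> R) (z : R) :
  seiffert f -> continuous_on_01 f -> 0 < z < 1 ->
  is_derive (seiffert_I f) z (f z / z).
Proof.
  intros Hf Hc Hz.
  rewrite <- (integrand_ext_pos f) by lra.
  apply is_derive_ext_loc with (RInt (integrand_ext f) 0).
  - apply (filter_imp (fun x : R => 0 < x)); [| now apply open_gt].
    intros x Hx; symmetry; now apply seiffert_I_ext.
  - now apply is_derive_RInt_integrand_ext.
Qed.

Lemma seiffert_I_lim_0 (f : R -> R) :
  seiffert f -> continuous_on_01 f ->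
  filterlim (seiffert_I f) (at_right 0) (locally 0).
Proof.
  intros Hf Hc.
  apply filterlim_ext_loc with (RInt (integrand_ext f) 0).
  - exists (mkposreal 1 Rlt_0_1); intros x _ Hx.
    symmetry; now apply seiffert_I_ext.
  - replace (locally 0) with (locally (RInt (integrand_ext f) 0 0))
      by now rewrite RInt_point.
    (* The right-hand limit follows from two-sided continuity of the primitive at [0]. *)
    refine (filterlim_filter_le_1 (F := locally 0) _ _ _);
      [apply filter_le_within |].
    apply (ex_derive_continuous (RInt (integrand_ext f) 0)).
    exists (integrand_ext f 0).
    apply is_derive_RInt_integrand_ext; trivial; lra.
Qed.

Lemma at_right_0_interval (b : R) :
  0 < b -> at_right 0 (fun x : R => 0 < x < b).
Proof.
  intros Hb; exists (mkposreal b Hb); intros x Hx Hpos.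
  change (Rabs (x - 0) < b) in Hx; apply Rabs_def2 in Hx; lra.
Qed.

Lemma is_derive_zero_const_01 (h : R -> R) (x y : R) :
  (forall t : R, 0 < t < 1 -> is_derive h t 0) ->
  0 < x < 1 -> 0 < y < 1 -> h x = h y.
Proof.
  intros Hh Hx Hy.
  (* Working with [Rmin] and [Rmax] avoids a case split on the order of [x] and [y] in the mean
     value theorem. *)
  assert (Hin : forall t, Rmin x y <= t <= Rmax x y -> 0 < t < 1).
  { intros t [Hl Hr]; split.
    - apply Rlt_le_trans with (2 := Hl), Rmin_glb_lt; lra.
    - apply Rle_lt_trans with (1 := Hr), Rmax_lub_lt; lra. }
  destruct (MVT_gen h x y (fun _ => 0)) as [c [_ Hc]].
  - intros t Ht; apply Hh, Hin; lra.
  - intros t Ht; apply derivable_continuous_pt.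
    exists 0; apply is_derive_Reals, Hh, Hin, Ht.
  - lra.
Qed.

Lemma eq_of_derive_eq_lim_0 (g h dg : R -> R) :
  filterlim g (at_right 0) (locally 0) ->
  filterlim h (at_right 0) (locally 0) ->
  (forall z : R, 0 < z < 1 -> is_derive g z (dg z)) ->
  (forall z : R, 0 < z < 1 -> is_derive h z (dg z)) ->
  forall z : R, 0 < z < 1 -> g z = h z.
Proof.
  intros Lg Lh Dg Dh z Hz.
  assert (Dd : forall t, 0 < t < 1 -> is_derive (fun x => g x - h x) t 0).
  { intros t Ht; replace 0 with (minus (dg t) (dg t)) by apply Rminus_diag.
    apply (is_derive_minus g h); auto. }
  assert (L0 : filterlim (fun x => g x - h x) (at_right 0) (locally 0)).
  { replace 0 with (0 + - 0) at 2 by ring.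
    apply (filterlim_comp_2 (H := locally (- 0)) g (fun x => - h x) Rplus Lg).
    - exact (filterlim_comp _ _ _ _ _ _ _ _ Lh (filterlim_opp 0)).
    - apply (filterlim_plus 0 (- 0)). }
  (* Being constant on [(0, 1)], the difference also tends to its value at [z]; uniqueness of limits
     then makes that value [0]. *)
  assert (Lc : filterlim (fun x => g x - h x) (at_right 0) (locally (g z - h z))).
  { apply filterlim_ext_loc with (fun _ : R => g z - h z).
    - apply (filter_imp (fun x : R => 0 < x < 1)).
      + intros x Hx; exact (is_derive_zero_const_01 _ z x Dd Hz Hx).
      + apply at_right_0_interval; lra.
    - apply filterlim_const. }
  pose proof (filterlim_locally_unique _ _ _ L0 Lc); lra.
Qed.

Theorem theorem1p1 (g : R -> R) :
  (filterlim g (at_right 0) (locally 0) /\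
   continuously_differentiable_on_01 g /\
   (forall z : R, 0 < z < 1 -> 1 / (1 + z) <= Derive g z <= 1 / (1 - z)))
  <->
  (exists f : R -> R,
     seiffert f /\ continuous_on_01 f /\
     (forall z : R, 0 < z < 1 -> g z = seiffert_I f z)).
Proof.
  split.
  - intros (Lg & [Dg Cg] & Bg).
    (* The only choice on [(0, 1)] for which [f u / u] is the derivative of [g]. *)
    set (f := fun u : R => u * Derive g u).
    assert (Hf : seiffert f).
    { intros z Hz; destruct (Bg z Hz) as [Hl Hr]; unfold f.
      replace (z / (1 + z)) with (z * (1 / (1 + z))) by (field; lra).
      replace (z / (1 - z)) with (z * (1 / (1 - z))) by (field; lra).
      split; apply Rmult_le_compat_l; lra. }
    assert (Hc : continuous_on_01 f).
    { intros z Hz; apply (continuous_mult (fun u : R => u) (Derive g)).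
      - apply continuous_id.
      - now apply Cg. }
    exists f; split; [exact Hf | split; [exact Hc |]].
    apply eq_of_derive_eq_lim_0 with (Derive g); trivial.
    + now apply seiffert_I_lim_0.
    + intros z Hz; now apply Derive_correct, Dg.
    + intros z Hz; replace (Derive g z) with (f z / z) by (unfold f; field; lra).
      now apply is_derive_seiffert_I.
  - intros (f & Hf & Hc & Hg).
    assert (Dg : forall z, 0 < z < 1 -> is_derive g z (f z / z)).
    { intros z Hz; apply is_derive_ext_loc with (seiffert_I f).
      - apply (filter_imp (fun x : R => 0 < x < 1)).
        + intros x Hx; symmetry; now apply Hg.
        + now apply locally_open_interval.
      - now apply is_derive_seiffert_I. }
    split; [| split; [split |]].
    + apply filterlim_ext_loc with (seiffert_I f).
      * apply (filter_imp (fun x : R => 0 < x < 1)).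
        -- intros x Hx; symmetry; now apply Hg.
        -- apply at_right_0_interval; lra.
      * now apply seiffert_I_lim_0.
    + intros z Hz; exists (f z / z); now apply Dg.
    (* [Derive g] is known only on [(0, 1)], but this is a neighbourhood of [z], so continuity
       carries over. *)
    + intros z Hz; apply continuous_ext_loc with (fun u : R => f u / u).
      * apply (filter_imp (fun x : R => 0 < x < 1)).
        -- intros x Hx; symmetry; now apply is_derive_unique, Dg.
        -- now apply locally_open_interval.
      * apply continuous_quotient; [lra | now apply Hc].
    + intros z Hz; rewrite (is_derive_unique _ _ _ (Dg z Hz)).
      now apply seiffert_quotient_bounds.
Qed.
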